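(* Let $X$ be a (not necessarily normal) complex $d\times d$ matrix and let $*\in\{L,R,C\}$. Then for every $d\times d$ density matrix $\rho_0$, $$\mathrm{Var}_{*,\rho_0}(X) \le \max_{\rho}\ \mathrm{Tr}\big[\rho\,|X-\mathrm{Tr}[\rho X]I|_*^2\big] = \min_{y\in\mathbb{C}} \big\|\,|X-yI|_*^2\,\big\|_\infty,$$ where the maximum is over all $d\times d$ density matrices $\rho$. Furthermore, the maximisation over $\rho$ can be restricted to density matrices of rank 1, i.e. of the form $\psi\psi^*$ with $\psi\in\mathbb{C}^d$ a normalised vector, without changing the value of the maximum.
   Context: A density matrix is a positive semidefinite matrix of trace 1. $I$ is the identity matrix and $\|\cdot\|_\infty$ the operator norm. The left, right and Cartesian moduli of a square matrix $X$ are $|X|_L=(X^*X)^{1/2}$, $|X|_R=(XX^* )^{1/2}$, $|X|_C=\sqrt{(|X|_L^2+|X|_R^2)/2}$. For a density matrix $\rho$, the corresponding variances are $\mathrm{Var}_{*,\rho}(X)=\mathrm{Tr}\big[\rho\,|X-\mathrm{Tr}[\rho X]I|_*^2\big]=\mathrm{Tr}[\rho|X|_*^2]-|\mathrm{Tr}[\rho X]|^2$, for $*=L,R,C$. *)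

(* Defs.v *)
From HB Require Import structures.
From mathcomp Require Import all_boot all_order all_algebra.
From mathcomp Require Import sesquilinear spectral complex.
From mathcomp Require Import boolp classical_sets reals.

Set Implicit Arguments.
Unset Strict Implicit.
Unset Printing Implicit Defensive.

Import Order.TTheory GRing.Theory Num.Theory.
Local Open Scope classical_set_scope.
Local Open Scope complex_scope.
Local Open Scope sesquilinear_scope.
Local Open Scope ring_scope.

Section Moduli.
Context {R : realType} {d : nat}.
Implicit Types (A X rho : 'M[R[i]]_d) (v psi : 'cV[R[i]]_d).

(* In R[i], [0 <= z] means that z is real and nonnegative. *)
Definition psd A : Prop :=
  A \is hermsymmx /\ forall v, 0 <= (v^t* *m A *m v) 0 0.

Definition density rho : Prop := psd rho /\ \tr rho = 1.

(* Square root by functional calculus in an orthonormal eigenbasis, A being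
   P^-1 * diag(spectral_diag A) * P with P := spectralmx A unitary; only
   meaningful when A is positive semidefinite. *)
Definition sqrtmx A : 'M[R[i]]_d :=
  invmx (spectralmx A) *m diag_mx (map_mx sqrtC (spectral_diag A))
    *m spectralmx A.

Definition absL X : 'M[R[i]]_d := sqrtmx (X^t* *m X).
Definition absR X : 'M[R[i]]_d := sqrtmx (X *m X^t*).
Definition absC X : 'M[R[i]]_d := sqrtmx (2^-1 *: (absL X ^+ 2 + absR X ^+ 2)).

Definition l2norm v : R := Num.sqrt (\sum_i ComplexField.Normc.normc (v i 0) ^+ 2).

Definition opnorm A : R := sup [set l2norm (A *m v) | v in [set v | l2norm v <= 1]].

End Moduli.

Variant modulus := ModL | ModR | ModC.

Definition mabs {R : realType} {d : nat} (k : modulus) (X : 'M[R[i]]_d) :=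
  match k with ModL => absL X | ModR => absR X | ModC => absC X end.

(* The trace is real for a density matrix rho, but is kept as an element of
   R[i]; see [is_max] for its use. *)
Definition Var {R : realType} {d : nat} (k : modulus) (rho X : 'M[R[i]]_d) : R[i] :=
  \tr (rho *m mabs k (X - (\tr (rho *m X))%:M) ^+ 2).

(* On R[i], [x <= y] holds iff Im x = Im y and Re x <= Re y, so a set of complex
   numbers with a maximum m that is real consists of real numbers. *)
Definition is_max {disp} {T : porderType disp} (S : set T) (m : T) : Prop :=
  S m /\ ubound S m.
Definition is_min {disp} {T : porderType disp} (S : set T) (m : T) : Prop :=
  S m /\ lbound S m.

Lemma psd_sqrtmx {R : realType} {d : nat} (A : 'M[R[i]]_d) :
  psd A -> psd (sqrtmx A) /\ sqrtmx A ^+ 2 = A.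
Proof.
case=> Ah Ap; set P := spectralmx A; set D := spectral_diag A.
have PU : P \is unitarymx by exact: spectral_unitarymx.
have PV : invmx P = P^t* by rewrite invmx_unitary.
have Pu : P \in unitmx by exact: spectral_unit.
have EA : A = invmx P *m diag_mx D *m P.
  by apply/orthomx_spectralP/hermitian_normalmx.
have D_ge0 i : 0 <= D 0 i.
  have := Ap (P^t* *m delta_mx i 0); rewrite EA trmx_mul map_mxM.
  rewrite trmxCK PV !mulmxA -[_ *m P *m P^t*]mulmxA (elimT unitarymxP PU) mulmx1.
  rewrite -[_ *m P *m P^t*]mulmxA (elimT unitarymxP PU) mulmx1.
  by rewrite -colE mul_mx_diag !mxE !eqxx rmorph1 mul1r.
split; last first.
  rewrite expr2 -!mulmxE /sqrtmx -/P -/D !mulmxA -[_ *m P *m _]mulmxA.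
  rewrite (mulmxV Pu) mulmx1 -[_ *m diag_mx _ *m diag_mx _]mulmxA mulmx_diag.
  rewrite [RHS]EA; congr (_ *m diag_mx _ *m _); apply/rowP => j.
  by rewrite !mxE -expr2 sqrtCK.
split=> [|v].
  apply/is_hermitianmxP; rewrite expr0 scale1r /sqrtmx -/P -/D PV.
  rewrite !trmx_mul !map_mxM trmxCK mulmxA; congr (_ *m _ *m _).
  rewrite tr_diag_mx map_diag_mx; congr diag_mx; apply/rowP => j.
  by rewrite !mxE; apply/esym/geC0_conj; rewrite sqrtC_ge0.
rewrite /sqrtmx -/P -/D PV.
have -> : v^t* *m (P^t* *m diag_mx (map_mx sqrtC D) *m P) *m v
  = (P *m v)^t* *m diag_mx (map_mx sqrtC D) *m (P *m v).
  by rewrite trmx_mul map_mxM !mulmxA.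
rewrite mul_mx_diag !mxE; apply: sumr_ge0 => j _; rewrite !mxE.
by rewrite mulrAC mulr_ge0 ?sqrtC_ge0// mulrC -normCK exprn_ge0.
Qed.

(* Main.v *)
From mathcomp Require Import topology normedtype derive.
Require Import Defs.
From mathcomp Require Import all_boot all_order all_algebra.
From mathcomp Require Import sesquilinear spectral complex.
From mathcomp Require Import boolp classical_sets reals.
From mathcomp Require Import ring.

(** Write [N] for the matrix of second moments of [X] ([X^* X], [X X^*] or their
    average). Whatever the modulus, the matrix [|X - y|^2] is
    [M(y) = N - y^* X - y X^* + |y|^2] ([second_moment_shift]), so that for a
    density matrix [rho] Steiner's identity reads
    [tr (rho M(y)) = Var(rho) + |tr (rho X) - y|^2]
    with [Var(rho) = tr (rho N) - |tr (rho X)|^2] ([trace_deviation]). In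
    particular [Var(rho) <= tr (rho M(y)) <= |M(y)|] for all [rho] and [y], and
    everything follows from a saddle point: a pure state with mean [y] and
    variance [m] such that [M(y) <= m] ([saddle_point]).

    The function [Var] is continuous on the compact convex set of density
    matrices, hence has a maximiser [rho] ([variance_maximiser]); put
    [y = tr (rho X)] and [m = Var(rho)]. As [Var] is concave, differentiating
    along the segments from [rho] to the other density matrices [sigma] gives
    [tr (sigma M(y)) <= m] ([maximiser_dominates]), that is [M(y) <= m].

    To replace [rho = V V^*] by a pure state, note that
    [tr (rho (m - M(y))) = 0] forces [(m - M(y)) V = 0]. By the convexity of the
    numerical range, some unit vector [psi] in the range of [V] has
    [psi^* X psi = tr (rho X) = y] ([quad_merge]). Since [M(y) psi = m psi], the
    variance of [X] in the state [psi] is [psi^* M(y) psi = m]. *)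

Set Implicit Arguments.
Unset Strict Implicit.

Import Order.TTheory GRing.Theory Num.Theory.
Local Open Scope classical_set_scope.
Local Open Scope complex_scope.
Local Open Scope sesquilinear_scope.
Local Open Scope ring_scope.

(** * Quadratic forms and the numerical range *)

Section QuadraticForms.
Context {C : numClosedFieldType} {n : nat}.
Implicit Types (A B : 'M[C]_n) (u v w : 'cV[C]_n).

(** Taken on matrices rather than on vectors: [quad A V] is the sum of the values
    of the form at the columns of [V], so that one notion covers the pure state
    [V : 'cV_n] and the mixed state [V *m V^t*]. *)
Definition quad {m} A (V : 'M[C]_(n, m)) : C := \tr (V^t* *m A *m V).

Lemma adjM m p q (V : 'M[C]_(m, p)) (W : 'M[C]_(p, q)) :
  (V *m W)^t* = W^t* *m V^t*.
Proof. by rewrite trmx_mul map_mxM. Qed.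

Lemma adjD m p (V W : 'M[C]_(m, p)) : (V + W)^t* = V^t* + W^t*.
Proof. by rewrite linearD map_mxD. Qed.

Lemma adjZ m p a (V : 'M[C]_(m, p)) : (a *: V)^t* = a^* *: V^t*.
Proof. by rewrite linearZ map_mxZ. Qed.

Lemma adj_scalar a : (a%:M : 'M[C]_n)^t* = (a^*)%:M.
Proof. by rewrite tr_scalar_mx map_scalar_mx. Qed.

Lemma mxtrace_adj (A : 'M[C]_n) : \tr (A^t*) = (\tr A)^*.
Proof. by rewrite rmorph_sum; apply: eq_bigr => i _; rewrite !mxE. Qed.

Lemma quad_trace m A (V : 'M[C]_(n, m)) : quad A V = \tr (V *m V^t* *m A).
Proof. by rewrite /quad mxtrace_mulC mulmxA. Qed.

Lemma quadD m A B (V : 'M[C]_(n, m)) : quad (A + B) V = quad A V + quad B V.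
Proof. by rewrite /quad mulmxDr mulmxDl mxtraceD. Qed.

Lemma quadZ m a A (V : 'M[C]_(n, m)) : quad (a *: A) V = a * quad A V.
Proof. by rewrite /quad -scalemxAr -scalemxAl mxtraceZ. Qed.

Lemma quad0 m (V : 'M[C]_(n, m)) : quad 0 V = 0.
Proof. by rewrite /quad mulmx0 mul0mx mxtrace0. Qed.

Lemma quad_scale m a A (V : 'M[C]_(n, m)) :
  quad A (a *: V) = `|a| ^+ 2 * quad A V.
Proof.
by rewrite /quad adjZ -scalemxAr -!scalemxAl !mxtraceZ mulrA normCK.
Qed.

Lemma quad1E m (V : 'M[C]_(n, m)) : quad 1%:M V = \sum_j \sum_i `|V i j| ^+ 2.
Proof.
rewrite /quad mulmx1; apply: eq_bigr => j _; rewrite !mxE.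
by apply: eq_bigr => i _; rewrite !mxE mulrC normCK.
Qed.

Lemma quad1_ge0 m (V : 'M[C]_(n, m)) : 0 <= quad 1%:M V.
Proof.
by rewrite quad1E sumr_ge0// => j _; rewrite sumr_ge0// => i _; rewrite exprn_ge0.
Qed.

Lemma quad1_eq0 m (V : 'M[C]_(n, m)) : (quad 1%:M V == 0) = (V == 0).
Proof.
apply/eqP/eqP => [/eqP|->]; last by rewrite /quad mulmx0 mxtrace0.
rewrite quad1E psumr_eq0 => [/allP/= V0|j _]; last first.
  by rewrite sumr_ge0// => i _; rewrite exprn_ge0.
apply/matrixP => i j; rewrite mxE; have /eqP/eqP := V0 j (mem_index_enum _).
rewrite psumr_eq0 => [/allP/= /(_ i (mem_index_enum _))|k _]; last by rewrite exprn_ge0.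
by rewrite sqrf_eq0 normr_eq0 => /eqP.
Qed.

(** If [v] is replaced by a suitable multiple [c *: v], the mixed terms of the
    form become real on the real span of [u] and [c *: v]. There
    [quad B (u + x *: (c *: v))] is a real quadratic polynomial in [x] with a
    positive constant and a negative leading coefficient, hence has a root. *)
Lemma quad_isotropic B u v : quad B u = 1 -> quad B v = -1 ->
  exists a b : C, a *: u + b *: v != 0 /\ quad B (a *: u + b *: v) = 0.
Proof.
move=> Bu Bv.
pose r := \tr (u^t* *m B *m v); pose s := \tr (v^t* *m B *m u).
have quadE a b : quad B (a *: u + b *: v) =
    `|a| ^+ 2 - `|b| ^+ 2 + a^* * b * r + a * b^* * s.
  rewrite /quad adjD !adjZ !mulmxDl !mulmxDr -!scalemxAl -!scalemxAr !mxtraceD.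
  rewrite !mxtraceZ -/(quad B u) -/(quad B v) Bu Bv -/r -/s !normCK.
  ring.
(* this choice makes [c * (r - s^* )], hence [c * r + c^* * s], real *)
pose c := if r == s^* then 1 else (r - s^*)^*.
have c0 : c != 0.
  rewrite /c; case: (eqVneq r) => [_|rs]; first exact: oner_neq0.
  by rewrite conjC_eq0 subr_eq0.
pose k := c * r + c^* * s.
have kR : k \is Num.real.
  rewrite CrealE /k rmorphD !rmorphM /= conjCK -subr_eq0 /c.
  case: (eqVneq r) => [->|_]; rewrite ?rmorph1 ?conjCK ?rmorphB /= ?conjCK;
  apply/eqP; ring.
pose D := k ^+ 2 + 4 * `|c| ^+ 2.
have D0 : 0 <= D by rewrite addr_ge0 ?real_exprn_even_ge0// mulr_ge0// exprn_ge0.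
pose x := (k + sqrtC D) / (2 * `|c| ^+ 2).
have xR : x \is Num.real.
  have DR : sqrtC D \is Num.real by rewrite ger0_real ?sqrtC_ge0.
  apply: rpred_div; first exact: rpredD.
  by apply: rpredM; [exact: realn|exact/rpredX/normr_real].
have nc0 : `|c| ^+ 2 != 0 by rewrite expf_neq0 ?normr_eq0.
have xE : 1 + x * k - x ^+ 2 * `|c| ^+ 2 = 0.
  have -> : 1 + x * k - x ^+ 2 * `|c| ^+ 2 =
     (D - sqrtC D ^+ 2) / (4 * `|c| ^+ 2).
    by rewrite /x /D; field; rewrite normr_eq0.
  by rewrite sqrtCK subrr mul0r.
exists 1, (x * c); rewrite scale1r; split.
  (* [u] is no multiple of [v], as the form has opposite signs at them *)
  apply/eqP => /eqP; rewrite addr_eq0 => /eqP u_v.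
  move: Bu; rewrite u_v -scaleNr quad_scale Bv mulrN1 => /eqP.
  rewrite eqr_oppLR => /eqP n1.
  by have := exprn_ge0 2 (normr_ge0 (- (x * c))); rewrite n1 oppr_ge0 ler10.
have := quadE 1 (x * c); rewrite scale1r => ->; rewrite -xE /k.
rewrite !rmorph1 rmorphM /= (CrealP xR) normrM exprMn normr1 (real_normK xR).
ring.
Qed.

(** Convexity of the numerical range (Toeplitz and Hausdorff), with the norms
    kept track of so that the vectors need not be normalised. Any nonzero
    combination with the right ratio of value to squared norm can be rescaled. *)
Lemma quad_merge2 A u v : exists a b : C,
  quad A (a *: u + b *: v) = quad A u + quad A v /\
  quad 1%:M (a *: u + b *: v) = quad 1%:M u + quad 1%:M v.
Proof.
have [->|u0] := eqVneq u 0.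
  by exists 0, 1; rewrite scale0r scale1r add0r /quad !mulmx0 !mxtrace0 !add0r.
pose nn := quad 1%:M u + quad 1%:M v.
have nn0 : nn != 0.
  rewrite gt_eqF// ltr_wpDr// ?quad1_ge0//.
  by rewrite lt_def quad1_ge0 quad1_eq0 u0.
(* shifting [A] by the value to be reached reduces to isotropic vectors *)
pose t := (quad A u + quad A v) / nn.
pose B := A - t *: 1%:M.
have quadB w : quad B w = quad A w - t * quad 1%:M w.
  by rewrite /B -scaleNr quadD quadZ mulNr.
suff [a [b [w0 Bw]]] : exists a b : C,
    a *: u + b *: v != 0 /\ quad B (a *: u + b *: v) = 0.
  pose w := a *: u + b *: v; pose c := sqrtC (nn / quad 1%:M w).
  have nw0 : quad 1%:M w != 0 by rewrite quad1_eq0.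
  have c2 : `|c| ^+ 2 * quad 1%:M w = nn.
    by rewrite -normrX sqrtCK ger0_norm ?divfK// divr_ge0// ?addr_ge0 ?quad1_ge0.
  exists (c * a), (c * b); rewrite -!scalerA -scalerDr -/w !quad_scale c2.
  split=> //; move: Bw; rewrite quadB -/w => /eqP; rewrite subr_eq0 => /eqP ->.
  by rewrite mulrCA c2 /t divfK.
have uv : quad B v = - quad B u.
  apply/eqP; rewrite -addr_eq0 !quadB addrACA -opprD -mulrDr (addrC (quad A v)).
  by rewrite (addrC (quad _ v)) -/nn /t divfK// subrr.
have [Bu0|Bu0] := eqVneq (quad B u) 0.
  by exists 1, 0; rewrite scale1r scale0r addr0.
have [||a [b [w0]]] := @quad_isotropic ((quad B u)^-1 *: B) u v.
- by rewrite quadZ mulVf.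
- by rewrite quadZ uv mulrN mulVf.
rewrite quadZ => /eqP; rewrite mulf_eq0 invr_eq0 (negPf Bu0) => /eqP Bw.
by exists a, b.
Qed.

(** Any expectation of [A] in a mixture of the columns of [V] is also attained
    by a pure state in the range of [V]: the columns are merged one by one. *)
Lemma quad_merge m A (V : 'M[C]_(n, m)) : exists c : 'cV[C]_m,
  quad A (V *m c) = quad A V /\ quad 1%:M (V *m c) = quad 1%:M V.
Proof.
elim: m V => [|m IHm] V.
  exists 0; rewrite mulmx0 (_ : V = 0); last by apply/matrixP => i [].
  by rewrite /quad !mulmx0 !mxtrace0.
have {}IHm (W : 'M[C]_(n, 1 + m)) : exists c : 'cV[C]_(1 + m),
    quad A (W *m c) = quad A W /\ quad 1%:M (W *m c) = quad 1%:M W.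
  have quadW B : quad B W = quad B (lsubmx W) + quad B (rsubmx W).
    rewrite -[in LHS](hsubmxK W) !quad_trace tr_row_mx map_col_mx mul_row_col.
    by rewrite mulmxDl mxtraceD.
  have [c [Ac c1]] := IHm (rsubmx W).
  have [a [b [Aab ab1]]] := quad_merge2 A (lsubmx W) (rsubmx W *m c).
  exists (col_mx a%:M (b *: c)).
  rewrite -[W in W *m _]hsubmxK mul_row_col mul_mx_scalar -scalemxAr.
  by rewrite Aab ab1 !quadW Ac c1.
exact: IHm.
Qed.

(** For a psd matrix [A] the left-hand side is nonnegative, which bounds the norm
    of [A *m v] in terms of the form. *)
Lemma quad_image_sub A v (t : C) : A^t* = A -> t^* = t ->
  quad A (v - t *: (A *m v)) =
  quad A v - 2 * t * quad 1%:M (A *m v) + t ^+ 2 * quad A (A *m v).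
Proof.
move=> Ah tJ.
rewrite /quad -scaleNr adjD adjZ adjM Ah rmorphN /= tJ.
rewrite !mulmxDl !mulmxDr -!scalemxAl -!scalemxAr !mulmxA mulmx1 !mxtraceD.
rewrite !mxtraceZ; ring.
Qed.

(** The left-hand side is nonnegative; for a unit vector [v] and [t] the norm of
    [A *m v], this is the Cauchy-Schwarz inequality for [v] and [A *m v]. *)
Lemma quad1_image_sub A v (t : C) : A^t* = A -> t^* = t ->
  quad 1%:M (A *m v - t *: v) =
  quad 1%:M (A *m v) - 2 * t * quad A v + t ^+ 2 * quad 1%:M v.
Proof.
move=> Ah tJ.
rewrite /quad -scaleNr adjD adjZ adjM Ah rmorphN /= tJ !mulmx1.
rewrite !mulmxDl !mulmxDr -!scalemxAl -!scalemxAr !mulmxA !mxtraceD.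
rewrite !mxtraceZ; ring.
Qed.

End QuadraticForms.

(** * Second moments and variances *)

Section Variance.
Context {C : numClosedFieldType} {n : nat}.
Implicit Types (N X rho sigma : 'M[C]_n) (y : C).

(** The three variances differ only in the matrix [N] of second moments, which is
    therefore a parameter. *)
Definition mxvar N X rho : C := \tr (rho *m N) - `|\tr (rho *m X)| ^+ 2.

(** The effect on the second moments [N] of [X] of recentering [X] at [y], see
    [second_moment_shift]. *)
Definition deviation N X y : 'M[C]_n :=
  N - y^* *: X - y *: X^t* + (`|y| ^+ 2)%:M.

Lemma deviation_adj N X y : N^t* = N -> (deviation N X y)^t* = deviation N X y.
Proof.
move=> Nh; rewrite /deviation !adjD adj_scalar -!scaleNr !adjZ Nh trmxCK.
rewrite !rmorphN /= conjCK (geC0_conj (exprn_ge0 2 (normr_ge0 y))).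
by congr (_ + _); rewrite addrAC.
Qed.

(** Steiner's identity: the mean is the best constant approximation. *)
Lemma trace_deviation N X rho y : rho^t* = rho -> \tr rho = 1 ->
  \tr (rho *m deviation N X y) = mxvar N X rho + `|\tr (rho *m X) - y| ^+ 2.
Proof.
move=> rh r1.
have rXJ : \tr (rho *m X^t*) = (\tr (rho *m X))^*.
  by rewrite -mxtrace_adj adjM rh mxtrace_mulC.
rewrite /deviation /mxvar !(mulmxDr, mulmxN) -!scalemxAr mul_mx_scalar.
rewrite !mxtraceD !raddfN /= !mxtraceZ rXJ r1 !normCK rmorphB /=; ring.
Qed.

(** In view of [trace_deviation], the increment of the variance from [rho] along
    the segment to [sigma] is, to first order in [t], that of the linear function
    [fun tau => \tr (tau *m deviation N X y)] with [y] the mean of [rho]. *)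
Lemma mxvar_segment N X rho sigma (t : C) : t^* = t ->
  mxvar N X ((1 - t) *: rho + t *: sigma) - mxvar N X rho =
  t * (mxvar N X sigma + `|\tr (sigma *m X) - \tr (rho *m X)| ^+ 2
       - mxvar N X rho - t * `|\tr (sigma *m X) - \tr (rho *m X)| ^+ 2).
Proof.
move=> tJ; rewrite /mxvar !mulmxDl -!scalemxAl !mxtraceD !mxtraceZ.
rewrite !normCK !(rmorphB, rmorphD, rmorphM) /= tJ rmorph1.
ring.
Qed.

Definition second_moment k X : 'M[C]_n :=
  match k with
  | ModL => X^t* *m X
  | ModR => X *m X^t*
  | ModC => 2^-1 *: (X^t* *m X + X *m X^t*)
  end.

Lemma second_moment_shift k X y :
  second_moment k (X - y%:M) = deviation (second_moment k X) X y.
Proof.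
have XyJ : (X - y%:M)^t* = X^t* - (y^*)%:M.
  by rewrite linearB map_mxB /= adj_scalar.
have L : second_moment ModL (X - y%:M) = deviation (second_moment ModL X) X y.
  rewrite /second_moment XyJ /deviation mulmxBl !mulmxBr mul_mx_scalar.
  rewrite !mul_scalar_mx scale_scalar_mx -normCKC opprD opprK addrA.
  by congr (_ + _); rewrite addrAC.
have Rt : second_moment ModR (X - y%:M) = deviation (second_moment ModR X) X y.
  rewrite /second_moment XyJ /deviation mulmxBl !mulmxBr !mul_mx_scalar.
  by rewrite mul_scalar_mx scale_scalar_mx -normCKC opprD opprK addrA.
case: k; [exact: L|exact: Rt|].
change (2^-1 *: (second_moment ModL (X - y%:M) + second_moment ModR (X - y%:M))
  = deviation (second_moment ModC X) X y).
rewrite L Rt /deviation /second_moment.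
by apply/matrixP => i j; rewrite !mxE; field.
Qed.

End Variance.

(** * Density matrices *)

Section Densities.
Context {R : realType} {d : nat}.
Implicit Types (A B N X V rho : 'M[R[i]]_d) (v : 'cV[R[i]]_d) (y : R[i]).

Lemma hermsymP A : reflect (A^t* = A) (A \is hermsymmx).
Proof. by apply: (iffP (is_hermitianmxP _ _ _)); rewrite expr0 scale1r. Qed.

Lemma psd_gram m (V : 'M[R[i]]_(d, m)) : psd (V *m V^t*).
Proof.
split=> [|v]; first by apply/hermsymP; rewrite adjM trmxCK.
rewrite !mulmxA -mulmxA -[v^t* *m V]trmxCK adjM trmxCK.
have := quad1_ge0 (V^t* *m v); rewrite /quad mulmx1 trace_mx11.
by rewrite adjM trmxCK.
Qed.

Lemma psd_factor A : psd A -> exists V, A = V *m V^t*.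
Proof.
move=> /psd_sqrtmx[[/hermsymP sh _] sA]; exists (sqrtmx A).
by rewrite sh mulmxE -expr2.
Qed.

Lemma density_gram m (V : 'M[R[i]]_(d, m)) :
  density (V *m V^t*) <-> quad 1%:M V = 1.
Proof.
rewrite quad_trace mulmx1; split=> [[]//|V1].
by split=> //; exact: psd_gram.
Qed.

Lemma quad_cV A v : (v^t* *m A *m v) 0 0 = quad A v.
Proof. by rewrite /quad trace_mx11. Qed.

Lemma trace_herm_real A B : A \is hermsymmx -> B \is hermsymmx ->
  \tr (A *m B) \is Num.real.
Proof.
move=> /hermsymP Ah /hermsymP Bh; apply/CrealP.
by rewrite -mxtrace_adj adjM Ah Bh mxtrace_mulC.
Qed.

Lemma density_trace_deviation N X rho y : density rho ->
  \tr (rho *m deviation N X y) = mxvar N X rho + `|\tr (rho *m X) - y| ^+ 2.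
Proof. by move=> [[/hermsymP rh _] r1]; exact: trace_deviation. Qed.

Lemma mxvar_real N X rho : N \is hermsymmx -> density rho ->
  mxvar N X rho \is Num.real.
Proof.
move=> Nh [[rh _] _]; rewrite rpredB ?trace_herm_real// ger0_real//.
by rewrite exprn_ge0.
Qed.

End Densities.

(** * Existence of a density matrix of maximal variance *)

Section ComplexContinuity.
Context {R : realType} {T : topologicalType}.
Implicit Types (f g : T -> R[i]).
Import numFieldNormedType.Exports.

(** Continuity for the product topology of [R * R], through which the operations of
    [R[i]] reduce to sums and products of real functions. *)
Definition ccontinuous f : Prop :=
  continuous (fun t => complex.Re (f t)) /\ continuous (fun t => complex.Im (f t)).

Lemma ccontinuous_cst z : ccontinuous (fun=> z).
Proof. by split=> t; exact: cvg_cst. Qed.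

Lemma ccontinuousD f g : ccontinuous f -> ccontinuous g ->
  ccontinuous (fun t => f t + g t).
Proof.
move=> [fr fi] [gr gi]; split=> t; under eq_fun do rewrite raddfD /=.
  by apply: cvgD; [exact: fr|exact: gr].
by apply: cvgD; [exact: fi|exact: gi].
Qed.

Lemma ccontinuousN f : ccontinuous f -> ccontinuous (fun t => - f t).
Proof.
move=> [fr fi]; split=> t; under eq_fun do rewrite raddfN /=.
  by apply: cvgN; exact: fr.
by apply: cvgN; exact: fi.
Qed.

Lemma ccontinuous_conj f : ccontinuous f -> ccontinuous (fun t => (f t)^*).
Proof.
move=> [fr fi]; split=> t.
  have -> : (fun t => complex.Re (f t)^*) = (fun t => complex.Re (f t)).
    by apply/funext => u; case: (f u).
  exact: fr.
have -> : (fun t => complex.Im (f t)^*) = (fun t => - complex.Im (f t)).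
  by apply/funext => u; case: (f u).
by apply: cvgN; exact: fi.
Qed.

Lemma ccontinuousM f g : ccontinuous f -> ccontinuous g ->
  ccontinuous (fun t => f t * g t).
Proof.
move=> [fr fi] [gr gi]; split=> t.
  have -> : (fun t => complex.Re (f t * g t)) = (fun t =>
      complex.Re (f t) * complex.Re (g t) - complex.Im (f t) * complex.Im (g t)).
    by apply/funext => u; case: (f u) (g u) => [a b] [a' b'].
  by apply: cvgB; apply: cvgM; [exact: fr|exact: gr|exact: fi|exact: gi].
have -> : (fun t => complex.Im (f t * g t)) = (fun t =>
    complex.Re (f t) * complex.Im (g t) + complex.Im (f t) * complex.Re (g t)).
  by apply/funext => u; case: (f u) (g u) => [a b] [a' b'].
by apply: cvgD; apply: cvgM; [exact: fr|exact: gi|exact: fi|exact: gr].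
Qed.

Lemma ccontinuous_sum (I : finType) (F : I -> T -> R[i]) :
  (forall i, ccontinuous (F i)) -> ccontinuous (fun t => \sum_i F i t).
Proof.
move=> Fc; elim: (index_enum I) => [|i s IHs].
  by under eq_fun do rewrite big_nil; exact: ccontinuous_cst.
under eq_fun do rewrite big_cons.
exact: ccontinuousD.
Qed.

Definition mxccontinuous m n (F : T -> 'M[R[i]]_(m, n)) : Prop :=
  forall i j, ccontinuous (fun t => F t i j).

Lemma mxccontinuousM m n p (F : T -> 'M[R[i]]_(m, n)) (G : T -> 'M[R[i]]_(n, p)) :
  mxccontinuous F -> mxccontinuous G -> mxccontinuous (fun t => F t *m G t).
Proof.
move=> Fc Gc i j; under eq_fun do rewrite mxE.
by apply: ccontinuous_sum => k; exact: ccontinuousM.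
Qed.

Lemma mxccontinuous_adj m n (F : T -> 'M[R[i]]_(m, n)) :
  mxccontinuous F -> mxccontinuous (fun t => (F t)^t*).
Proof.
by move=> Fc i j; under eq_fun do rewrite !mxE; exact: ccontinuous_conj.
Qed.

Lemma ccontinuous_mxtrace n (F : T -> 'M[R[i]]_n) :
  mxccontinuous F -> ccontinuous (fun t => \tr (F t)).
Proof. by move=> Fc; exact: ccontinuous_sum. Qed.

End ComplexContinuity.

Section Maximiser.
Context {R : realType} {d : nat}.
Import numFieldNormedType.Exports.

(* Matrices are parametrised by the real coordinates of their entries, and
   density matrices by the unit sphere through [V |-> V *m V^t*]: boundedness and
   closedness are immediate there. *)
Let I : finType := ('I_d * 'I_d * bool)%type.

Let cmx (u : 'rV[R]_#|I|) : 'M[R[i]]_d := \matrix_(i, j)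
  (u 0 (enum_rank (i, j, false)) +i* u 0 (enum_rank (i, j, true))).

Let cmx_surj V : exists u, cmx u = V.
Proof.
exists (\row_k let: (i, j, b) := enum_val k in
  if b then complex.Im (V i j) else complex.Re (V i j)).
by apply/matrixP => i j; rewrite !mxE !enum_rankK; case: (V i j).
Qed.

Let cmx_continuous : mxccontinuous cmx.
Proof.
move=> i j; split=> u; under eq_fun do rewrite mxE /=; exact: coord_continuous.
Qed.

Let trace_continuous A : ccontinuous (fun u => \tr (cmx u *m (cmx u)^t* *m A)).
Proof.
apply: ccontinuous_mxtrace; apply: mxccontinuousM.
  by apply: mxccontinuousM => //; exact: mxccontinuous_adj.
by move=> i j; exact: ccontinuous_cst.
Qed.

(* the trace is that of [density_gram], put in the form of [trace_continuous] *)
Let sphere : set 'rV[R]_#|I| :=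
  [set u | \tr (cmx u *m (cmx u)^t* *m 1%:M) = 1].

Let sphere_compact : compact sphere.
Proof.
(* a closed subset of a cube *)
apply: (@subclosed_compact _ _
    [set u : 'rV[R]_#|I| | forall i, `[-1, 1]%classic (u ord0 i)]).
- have [sc _] := trace_continuous 1%:M.
  have -> : sphere = (fun u => complex.Re
      (\tr (cmx u *m (cmx u)^t* *m 1%:M))) @^-1` [set 1].
    apply/seteqP; split=> u /=; rewrite /sphere/= => u1; first by rewrite u1.
    (* the trace is nonnegative, so that its imaginary part vanishes *)
    have := quad1_ge0 (cmx u); rewrite quad_trace; move: u1.
    by case: (\tr _) => a b /= ->; rewrite lecE /= => /andP[/eqP-> _].
  exact: (continuous_closedP _).1 sc _ (@closed_eq _ 1).
- apply: (@rV_compact R #|I| (fun=> `[-1, 1]%classic)) => _.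
  exact: segment_compact.
- move=> u u1 k; have [[[i j] b] ->] : exists x, k = enum_rank x.
    by exists (enum_val k); rewrite enum_valK.
  have : `|cmx u i j| ^+ 2 <= 1.
    rewrite -u1 -quad_trace quad1E (bigD1 j)//= (bigD1 i)//= -addrA lerDl.
    rewrite addr_ge0// ?sumr_ge0// => l _; rewrite ?sumr_ge0 ?exprn_ge0// => *.
    by rewrite exprn_ge0.
  rewrite -add_Re2_Im2 lecR mxE /= in_itv /= -ler_norml => uij.
  rewrite -(@expr_le1 _ 2)// real_normK ?num_real//; apply: le_trans uij.
  by case: b; rewrite ?lerDl ?lerDr sqr_ge0.
Qed.

Lemma density_maximiser (d_gt0 : (0 < d)%N) (f : 'M[R[i]]_d -> R) :
  continuous (fun u => f (cmx u *m (cmx u)^t* )) ->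
  exists rho, density rho /\ forall sigma, density sigma -> f sigma <= f rho.
Proof.
move=> fc.
have sphereE u : sphere u <-> density (cmx u *m (cmx u)^t* ).
  by rewrite /sphere /= -quad_trace; split=> /density_gram.
have sphere0 : sphere !=set0.
  have [u uE] := cmx_surj (delta_mx (Ordinal d_gt0) (Ordinal d_gt0)).
  exists u; apply/sphereE; rewrite uE; apply/density_gram.
  rewrite quad1E (bigD1 (Ordinal d_gt0))//= (bigD1 (Ordinal d_gt0))//= !mxE !eqxx.
  rewrite normr1 expr1n !big1 ?addr0// => [i /negPf ni|i /negPf ni].
    by rewrite big1// => j _; rewrite mxE ni andbF normr0 expr0n.
  by rewrite mxE ni normr0 expr0n.
have [u /[!inE] /sphereE u1 umax] :=
  compact_EVT_max sphere0 sphere_compact (continuous_subspaceT fc).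
exists (cmx u *m (cmx u)^t* ); split=> // sigma sd.
have [V sE] := psd_factor sd.1; have [w wE] := cmx_surj V.
by rewrite sE -wE; apply: umax; rewrite inE; apply/sphereE; rewrite wE -sE.
Qed.

Lemma variance_maximiser (d_gt0 : (0 < d)%N) (N X : 'M[R[i]]_d) :
  N \is hermsymmx ->
  exists rho, density rho /\
    forall sigma, density sigma -> mxvar N X sigma <= mxvar N X rho.
Proof.
move=> Nh.
have [|rho [rd rmax]] := @density_maximiser d_gt0
    (fun rho => complex.Re (mxvar N X rho)).
  have [] // : ccontinuous (fun u => mxvar N X (cmx u *m (cmx u)^t* )).
  under eq_fun do rewrite /mxvar normCK.
  apply: ccontinuousD => //; apply: ccontinuousN; apply: ccontinuousM => //.
  exact: ccontinuous_conj.
exists rho; split=> [|sigma sd]; first exact: rd.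
rewrite -(RRe_real (mxvar_real X Nh sd)) -(RRe_real (mxvar_real X Nh rd)) lecR.
exact: rmax.
Qed.

End Maximiser.

(** * The saddle point *)

Section VarianceGame.
Context {R : realType} {d : nat}.
Implicit Types (A M N X rho sigma : 'M[R[i]]_d) (psi v : 'cV[R[i]]_d) (y z : R[i]).

(** First-order condition at a maximiser. By [mxvar_segment], moving from [rho]
    towards [sigma] changes the variance by [t * (D - t * K)], where [D] is the
    excess of the left-hand side over the right-hand side; if [D] were positive,
    a small [t] would increase the variance. *)
Lemma maximiser_dominates N X rho :
    N \is hermsymmx -> density rho ->
    (forall sigma, density sigma -> mxvar N X sigma <= mxvar N X rho) ->
  forall sigma, density sigma ->
    \tr (sigma *m deviation N X (\tr (rho *m X))) <= mxvar N X rho.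
Proof.
move=> Nh rd rmax sigma sd; rewrite density_trace_deviation//.
set K := `|_| ^+ 2; have K0 : 0 <= K by rewrite exprn_ge0.
rewrite -subr_le0; set D := _ - mxvar _ _ rho.
have DR : D \is Num.real.
  apply: rpredB; last exact: mxvar_real.
  by apply: rpredD; [exact: mxvar_real|exact: ger0_real].
rewrite real_leNgt ?real0//; apply/negP => D0.
(* [t] only has to satisfy [0 < t <= 1] and [t * K < D] *)
have DK0 : 0 < D + K by rewrite ltr_pwDl.
pose t := D / (D + K).
have t0 : 0 < t by rewrite divr_gt0.
have t1 : t <= 1 by rewrite ler_pdivrMr// mul1r lerDl.
have tK : t * K < D.
  by rewrite /t mulrAC ltr_pdivrMr// ltr_pM2l// ltr_pwDl.
have tJ : t^* = t by apply: geC0_conj; exact: ltW.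
clearbody t.
pose rt := (1 - t) *: rho + t *: sigma.
have rtd : density rt.
  have [[/hermsymP rh rp] r1] := rd; have [[/hermsymP sh sp] s1] := sd.
  split; last by rewrite mxtraceD !mxtraceZ r1 s1; ring.
  split=> [|v].
    apply/hermsymP; rewrite adjD !adjZ rh sh rmorphB rmorph1 /=.
    by rewrite tJ.
  rewrite quad_cV quadD !quadZ -!quad_cV.
  by rewrite addr_ge0// mulr_ge0 ?subr_ge0// ltW.
have := rmax _ rtd; apply/negP; rewrite -real_ltNge ?mxvar_real//.
rewrite -subr_gt0.
suff -> : mxvar N X rt - mxvar N X rho = t * (D - t * K).
  by rewrite mulr_gt0// subr_gt0.
exact: mxvar_segment.
Qed.

(** Writing [A = S *m S^t*], the trace is the sum of the squared moduli of the
    entries of [S^t* *m V]. *)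
Lemma psd_quad_eq0 m A (V : 'M[R[i]]_(d, m)) :
  psd A -> \tr (V *m V^t* *m A) = 0 -> A *m V = 0.
Proof.
move=> /psd_factor[S ->]; rewrite -quad_trace => V0.
suff /eqP SV : S^t* *m V == 0 by rewrite -mulmxA SV mulmx0.
rewrite -quad1_eq0; apply/eqP.
by rewrite -[RHS]V0 /quad mulmx1 adjM trmxCK !mulmxA.
Qed.

Lemma psd_dominated M (l : R[i]) : M \is hermsymmx -> l \is Num.real ->
  (forall v, quad M v <= l * quad 1%:M v) -> psd (l%:M - M).
Proof.
move=> /hermsymP Mh lR lM; split=> [|v].
  by apply/hermsymP; rewrite linearB map_mxB /= Mh adj_scalar (CrealP lR).
by rewrite quad_cV -scalemx1 -scaleN1r quadD !quadZ mulN1r subr_ge0.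
Qed.

Lemma deviation_herm N X y : N \is hermsymmx -> deviation N X y \is hermsymmx.
Proof. by move=> /hermsymP Nh; apply/hermsymP; exact: deviation_adj. Qed.

Lemma dominated_quad M (l : R[i]) :
    (forall sigma, density sigma -> \tr (sigma *m M) <= l) ->
  forall v, quad M v <= l * quad 1%:M v.
Proof.
move=> lM v; have [->|v0] := eqVneq v 0.
  by rewrite /quad !mulmx0 !mxtrace0 mulr0.
have n0 : 0 < quad 1%:M v by rewrite lt_def quad1_eq0 v0 quad1_ge0.
have nV : `|sqrtC (quad 1%:M v)^-1| ^+ 2 = (quad 1%:M v)^-1.
  by rewrite -normrX sqrtCK ger0_norm// invr_ge0 ltW.
pose psi := sqrtC (quad 1%:M v)^-1 *: v.
have /lM : density (psi *m psi^t*).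
  by apply/density_gram; rewrite quad_scale nV mulVf// gt_eqF.
by rewrite -quad_trace quad_scale nV mulrC ler_pdivrMr.
Qed.

(** The maximiser [rho] given by compactness may be mixed. As [deviation N X y],
    with [y] the mean of [rho], is at most the variance of [rho] and has that
    trace against [rho], the range of [rho] consists of eigenvectors for the top
    eigenvalue; [quad_merge] finds among them a pure state with mean [y], and it
    has the same variance. *)
Lemma saddle_point (d_gt0 : (0 < d)%N) N X : N \is hermsymmx ->
  exists psi, [/\ quad 1%:M psi = 1,
    forall sigma, density sigma -> mxvar N X sigma <= mxvar N X (psi *m psi^t*) &
    forall v, quad (deviation N X (quad X psi)) v <=
              mxvar N X (psi *m psi^t*) * quad 1%:M v].
Proof.
move=> Nh; have [rho [rd rmax]] := variance_maximiser d_gt0 X Nh.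
pose y := \tr (rho *m X); pose M := deviation N X y.
have lM := dominated_quad (maximiser_dominates Nh rd rmax).
have Mh : M \is hermsymmx by exact: deviation_herm.
have Pp : psd ((mxvar N X rho)%:M - M).
  by apply: psd_dominated => //; exact: mxvar_real.
have [V rV] := psd_factor rd.1.
have V0 : ((mxvar N X rho)%:M - M) *m V = 0.
  apply: psd_quad_eq0 => //; rewrite -rV mulmxBr mul_mx_scalar raddfB /= mxtraceZ.
  by rewrite density_trace_deviation// rd.2 mulr1 subrr normr0 expr0n addr0 subrr.
have [psi [psi1 psiX Mpsi]] : exists psi, [/\ quad 1%:M psi = 1, quad X psi = y &
    ((mxvar N X rho)%:M - M) *m psi = 0].
  have [c [Xc c1]] := quad_merge X V; exists (V *m c).
  split; [|by rewrite Xc quad_trace -rV|by rewrite mulmxA V0 mul0mx].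
  by rewrite c1; apply/density_gram; rewrite -rV.
have psiE : mxvar N X (psi *m psi^t*) = mxvar N X rho.
  have pd : density (psi *m psi^t*) by apply/density_gram.
  have := density_trace_deviation N X y pd.
  rewrite -[\tr (_ *m X)]quad_trace psiX subrr normr0 expr0n addr0 => <-.
  move: Mpsi => /eqP; rewrite mulmxBl subr_eq0 mul_scalar_mx => /eqP MV.
  rewrite -quad_trace /quad -mulmxA -[deviation _ _ _ *m _]MV -scalemxAr mxtraceZ.
  by rewrite -[X in _ = X]mulr1 -psi1 /quad mulmx1.
by exists psi; rewrite psiE psiX.
Qed.

End VarianceGame.

(** * The operator norm of a positive semidefinite matrix *)

Section OperatorNorm.
Context {R : realType} {d : nat}.
Implicit Types (M : 'M[R[i]]_d) (u v w psi : 'cV[R[i]]_d).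

Lemma l2norm_ge0 v : 0 <= l2norm v.
Proof. exact: sqrtr_ge0. Qed.

Lemma l2norm_sqr v : (l2norm v ^+ 2)%:C = quad 1%:M v.
Proof.
rewrite sqr_sqrtr ?sumr_ge0// => [|i _]; last exact: sqr_ge0.
rewrite quad1E big_ord1 rmorph_sum; apply: eq_bigr => i _.
by rewrite rmorphXn.
Qed.

Lemma l2norm_eq1 v : l2norm v = 1 <-> quad 1%:M v = 1.
Proof.
rewrite -l2norm_sqr; split=> [->|]; first by rewrite expr1n.
by case=> /eqP; rewrite sqrp_eq1 ?l2norm_ge0// => /eqP.
Qed.

Lemma l2norm_le1 v : (l2norm v <= 1) = (quad 1%:M v <= 1).
Proof. by rewrite -l2norm_sqr (lecR _ 1) expr_le1 ?l2norm_ge0. Qed.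

(** For [t >= 0] the form at [v - t *: (M *m v)] is nonnegative and, by
    [quad_image_sub], at most [l |v|^2 - 2 t |M v|^2 + t^2 l |M v|^2]; for
    [l > 0] the best choice is [t = l^-1]. *)
Lemma psd_contraction M (l : R[i]) v : psd M -> 0 <= l ->
  (forall u, quad M u <= l * quad 1%:M u) ->
  quad 1%:M (M *m v) <= l ^+ 2 * quad 1%:M v.
Proof.
move=> [Mh Mp] l0 lM.
set g := quad 1%:M (M *m v).
have key (t : R[i]) : 0 <= t -> 2 * t * g - t ^+ 2 * (l * g) <= l * quad 1%:M v.
  move=> t0; have := Mp (v - t *: (M *m v)).
  rewrite quad_cV quad_image_sub; [|exact/hermsymP|exact: geC0_conj].
  rewrite -/g => h.
  have h1 := lM v; have h2 := lM (M *m v).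
  have h3 : t ^+ 2 * quad M (M *m v) <= t ^+ 2 * (l * g).
    by rewrite ler_wpM2l// exprn_ge0.
  rewrite lerBlDr (le_trans _ (lerD h1 h3))// -subr_ge0.
  by rewrite addrAC.
have [l00|ln0] := eqVneq l 0.
  (* the bound is then linear in [t], and any positive [t] will do *)
  have := key 1 ler01; rewrite l00 !mul0r mulr0 subr0 mulr1 expr0n/= mul0r.
  by rewrite pmulr_rle0.
have lp : 0 < l by rewrite lt_def ln0.
have := key l^-1; rewrite invr_ge0 => /(_ l0).
have -> : 2 * l^-1 * g - l^-1 ^+ 2 * (l * g) = l^-1 * g by field.
by rewrite mulrC ler_pdivrMr// mulrAC -expr2.
Qed.

Lemma opnorm_ubound M (l : R) : psd M -> 0 <= l ->
  (forall u, quad M u <= l%:C * quad 1%:M u) ->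
  ubound [set l2norm (M *m v) | v in [set v | l2norm v <= 1]] l.
Proof.
move=> Mp l0 lM _ [v /= v1 <-].
rewrite -(@ler_pXn2r _ 2) ?nnegrE ?l2norm_ge0// -lecR l2norm_sqr rmorphXn /=.
apply: (le_trans (psd_contraction v Mp _ lM)); first by rewrite ler0c.
by rewrite ler_piMr ?exprn_ge0 ?ler0c// -l2norm_le1.
Qed.

Lemma opnorm_le M (l : R) : psd M -> 0 <= l ->
  (forall u, quad M u <= l%:C * quad 1%:M u) -> opnorm M <= l.
Proof.
move=> Mp l0 lM; apply: ge_sup; last exact: opnorm_ubound.
exists (l2norm (M *m 0)), 0 => //=.
by rewrite l2norm_le1 /quad mulmx0 mxtrace0.
Qed.

Lemma quad_le_l2norm M psi : psd M -> quad 1%:M psi = 1 ->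
  quad M psi <= (l2norm (M *m psi))%:C.
Proof.
move=> [Mh Mp] p1; set s := (l2norm _)%:C.
have s0 : 0 <= s by rewrite ler0c l2norm_ge0.
have sR : s^* = s by exact: geC0_conj.
have := quad1_ge0 (M *m psi - s *: psi).
have -> : quad 1%:M (M *m psi - s *: psi) = 2 * s * (s - quad M psi).
  rewrite quad1_image_sub//; last exact/hermsymP.
  rewrite -[quad 1%:M (M *m _)]l2norm_sqr rmorphXn /= -/s p1; ring.
have [sz|sn] := eqVneq s 0; last first.
  by rewrite pmulr_rge0 ?subr_ge0// mulr_gt0// lt_def sn.
move=> _; suff -> : quad M psi = 0 by [].
have /eqP : quad 1%:M (M *m psi) = 0.
  by rewrite -l2norm_sqr rmorphXn /= -/s sz expr0n.
by rewrite quad1_eq0 /quad -mulmxA => /eqP ->; rewrite mulmx0 mxtrace0.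
Qed.

(** The saddle point for the zero observable: the variance is then the linear
    function [fun rho => \tr (rho *m M)], and its maximum bounds the form. *)
Lemma psd_quad_bounded (d_gt0 : (0 < d)%N) M : psd M ->
  exists2 l : R, 0 <= l & forall u, quad M u <= l%:C * quad 1%:M u.
Proof.
move=> [Mh Mp]; have [phi [phi1 _ phidom]] := saddle_point d_gt0 0 Mh.
have phid : density (phi *m phi^t*) by apply/density_gram.
have mR := mxvar_real 0 Mh phid.
exists (complex.Re (mxvar M 0 (phi *m phi^t*))).
  rewrite -ler0c RRe_real//.
  by rewrite /mxvar mulmx0 mxtrace0 normr0 expr0n subr0 -quad_trace -quad_cV.
move=> u; rewrite RRe_real//; have := phidom u.
rewrite quad0 /deviation conjC0 !scale0r !subr0 normr0 expr0n.
by rewrite (_ : 0%:M = 0) ?addr0//; apply/matrixP => i j; rewrite !mxE mul0rn.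
Qed.

Lemma quad_le_opnorm (d_gt0 : (0 < d)%N) M psi :
  psd M -> quad 1%:M psi = 1 -> quad M psi <= (opnorm M)%:C.
Proof.
move=> Mp p1; apply: (le_trans (quad_le_l2norm Mp p1)); rewrite lecR.
apply: ub_le_sup; last by exists psi => //=; rewrite l2norm_le1 p1.
have [l l0 lM] := psd_quad_bounded d_gt0 Mp.
by exists l; exact: opnorm_ubound.
Qed.

End OperatorNorm.

(** * The moduli of a matrix *)

Section Moduli.
Context {R : realType} {d : nat}.
Implicit Types (X rho : 'M[R[i]]_d).

Lemma psd_second_moment k X : psd (second_moment k X).
Proof.
have pL : psd (X^t* *m X) by rewrite -[X in _ *m X]trmxCK; exact: psd_gram.
have pR : psd (X *m X^t*) by exact: psd_gram.
case: k; [exact: pL|exact: pR|split=> [|v]].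
  apply/hermsymP; rewrite adjZ adjD !adjM trmxCK.
  by rewrite geC0_conj// invr_ge0.
rewrite quad_cV quadZ quadD -!quad_cV mulr_ge0 ?invr_ge0//.
by rewrite addr_ge0 ?pL.2 ?pR.2.
Qed.

Lemma mabs_sqr k X : mabs k X ^+ 2 = second_moment k X.
Proof.
have L : absL X ^+ 2 = X^t* *m X := (psd_sqrtmx (psd_second_moment ModL X)).2.
have Rt : absR X ^+ 2 = X *m X^t* := (psd_sqrtmx (psd_second_moment ModR X)).2.
case: k; [exact: L|exact: Rt|rewrite [mabs _ _]/absC L Rt].
exact: (psd_sqrtmx (psd_second_moment ModC X)).2.
Qed.

Lemma VarE k rho X : density rho -> Var k rho X = mxvar (second_moment k X) X rho.
Proof.
move=> rd; rewrite /Var mabs_sqr second_moment_shift density_trace_deviation//.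
by rewrite subrr normr0 expr0n addr0.
Qed.

End Moduli.

(** * The minimax theorem *)

Theorem theorem9 (R : realType) (d : nat) (d_gt0 : (0 < d)%N)
    (X : 'M[R[i]]_d) (k : modulus) :
  exists m : R[i],
    [/\ forall rho0 : 'M[R[i]]_d, density rho0 -> Var k rho0 X <= m,
        is_max [set Var k rho X | rho in [set rho | density rho]] m,
        is_min [set (opnorm (mabs k (X - y%:M) ^+ 2))%:C | y in [set: R[i]]] m,
        is_max [set Var k rho X
               | rho in [set rho | density rho /\ \rank rho = 1%N]] m
      & is_max [set Var k (psi *m psi^t*) X
               | psi in [set psi : 'cV[R[i]]_d | l2norm psi = 1]] m].
Proof.
have Nh := (psd_second_moment k X).1.
have [psi [psi1 psimax psidom]] := saddle_point d_gt0 X Nh.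
have pd : density (psi *m psi^t*) by apply/density_gram.
set m := mxvar _ _ _ in psimax psidom.
have Varle rho0 : density rho0 -> Var k rho0 X <= m.
  by move=> rd; rewrite (VarE k X rd); apply: psimax.
have mE : Var k (psi *m psi^t*) X = m by rewrite VarE.
have mR : (complex.Re m)%:C = m by rewrite RRe_real//; exact: mxvar_real.
have Dp y : psd (deviation (second_moment k X) X y).
  by rewrite -second_moment_shift; exact: psd_second_moment.
exists m; split=> //.
- by split; [exists (psi *m psi^t*)|move=> _ [rho rd <-]; exact: Varle].
- have lower y : m <= (opnorm (mabs k (X - y%:M) ^+ 2))%:C.
    rewrite mabs_sqr second_moment_shift.
    apply: le_trans (quad_le_opnorm d_gt0 (Dp y) psi1).
    by rewrite quad_trace density_trace_deviation// lerDl exprn_ge0.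
  split; last by move=> _ [y _ <-].
  (* the optimal centre is the mean of [psi] *)
  exists (quad X psi) => //; apply/eqP; rewrite eq_le lower andbT.
  rewrite mabs_sqr second_moment_shift -mR lecR; apply: opnorm_le => //; last first.
    by move=> u; rewrite mR.
  rewrite -ler0c mR; have := psidom psi; rewrite psi1 mulr1; apply: le_trans.
  by rewrite -quad_cV; exact: (Dp _).2.
- split; last by move=> _ [rho [rd _] <-]; exact: Varle.
  exists (psi *m psi^t*) => //; split=> //; apply/eqP; rewrite eqn_leq.
  rewrite (leq_trans (mxrankM_maxl _ _) (rank_leq_col _))/= lt0n mxrank_eq0.
  apply/eqP => p0; have := pd.2; rewrite p0 mxtrace0 => /esym/eqP.
  by rewrite oner_eq0.
- split; first by exists psi => //=; exact/l2norm_eq1.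
  by move=> _ [phi /l2norm_eq1/density_gram phid <-]; exact: Varle.
Qed.
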